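(* Let $q>1$ be an integer, let $P=(p_0,\dots,p_{q-1})$ and $R=(r_0,\dots,r_{q-1})$ satisfy $p_j>0$, $r_j>0$ for all $j$, $\sum_j p_j=1$ and $\sum_j r_j=1$. Let $(n_k)_{k\ge1}$ be a sequence of positive integers with $n_i\ne n_j$ for $i\neq j$ and such that for every $n\in\mathbb N$ there is $k_0$ with $n_{k_0}=n$. Let $$G(s)=\gamma_{i_{n_1}}+\sum_{k=2}^{\infty}\left(\gamma_{i_{n_k}}\prod_{t=1}^{k-1}r_{i_{n_t}}\right),\qquad s=\Delta^P_{i_1i_2\ldots i_k\ldots}\in[0,1].$$ Then the following hold: (1) $G$ is continuous at every $P$-irrational point of $[0,1]$. (2) $G$ is continuous at the $P$-rational point $$s_0=\Delta^{P}_{i_1i_2\ldots i_{m-1}i_m000\ldots}=\Delta^{P}_{i_1i_2\ldots i_{m-1}[i_m-1][q-1][q-1][q-1]\ldots}$$ whenever the sequence $(n_k)$ is such that, with $k_0=\max\{k: n_k\in\{1,2,\dots,m\}\}$, one has $n_{k_0}=m$ and $n_1,n_2,\dots,n_{k_0-1}\in\{1,2,\dots,m-1\}$. Otherwise, the $P$-rational point $s_0$ is a point of discontinuity of $G$. (3) The set $G_D$ of all points of discontinuity of $G$ is a countable, finite, or empty set (depending on the sequence $(n_k)$).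
   Context: For $i\in\{0,\dots,q-1\}$ put $\beta_0=\gamma_0=0$ and, for $i\ne0$, $\beta_i=\sum_{l=0}^{i-1}p_l$, $\gamma_i=\sum_{l=0}^{i-1}r_l$. For digits $i_k\in\{0,1,\dots,q-1\}$ write $$\Delta^P_{i_1i_2\ldots i_k\ldots}:=\beta_{i_1}+\sum_{k=2}^\infty\Big(\beta_{i_k}\prod_{j=1}^{k-1}p_{i_j}\Big)\in[0,1].$$ Every $s\in[0,1]$ has such a representation. Numbers of the form $\Delta^P_{i_1\ldots i_{m-1}i_m000\ldots}=\Delta^P_{i_1\ldots i_{m-1}[i_m-1][q-1][q-1]\ldots}$ with $i_m\ne0$ have two representations and are called $P$-rational; all other numbers in $[0,1]$ have a unique representation and are called $P$-irrational. At a $P$-rational point the two representations may give two different values of the series defining $G$, and these are the right-hand limit (representation ending in zeros) and left-hand limit (representation ending in digits $q-1$) of $G$ at that point. *)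

(* Defs.v *)
From HB Require Import structures.
From mathcomp Require Export all_boot all_order all_algebra.
From mathcomp Require Export all_classical all_reals all_analysis.
Export Order.TTheory GRing.Theory Num.Theory.
Export numFieldNormedType.Exports.

Set Implicit Arguments.
Unset Strict Implicit.
Unset Printing Implicit Defensive.

Local Open Scope classical_set_scope.
Local Open Scope ring_scope.

(* All sequences are indexed from 0: digit number k of the mathematical text
   is [i k.-1], and an index n_k of the text is [(n k.-1).+1].  A sequence
   (n_k) of pairwise distinct positive integers attaining every positive
   integer is thus an injective and surjective map nat -> nat. *)

Definition rearrangement (n : nat -> nat) : Prop :=
  injective n /\ (forall N, exists k, n k = N).

(* beta_i for p, gamma_i for r; the empty sum gives the value 0 at i = 0. *)
Definition cumul (R : realType) (q : nat) (p : 'I_q -> R) (i : 'I_q) : R :=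
  \sum_(l < q | (l < i)%N) p l.

(* Delta^P_{i_1 i_2 ...}; the empty product makes beta_{i_1} the term of
   index 0. *)
Definition Delta (R : realType) (q : nat) (p : 'I_q -> R) (i : nat -> 'I_q)
    : R :=
  limn (series (fun k => cumul p (i k) * \prod_(j < k) p (i j))).

(* The digit of index m is the last nonzero one. *)
Definition zero_tail (q : nat) (m : nat) (i : nat -> 'I_q) : Prop :=
  (0 < i m)%N /\ (forall k, (m < k)%N -> i k = 0%N :> nat).

Definition P_rational (R : realType) (q : nat) (p : 'I_q -> R) (s : R) : Prop :=
  exists m (i : nat -> 'I_q), zero_tail m i /\ s = Delta p i.

Definition P_irrational (R : realType) (q : nat) (p : 'I_q -> R) (s : R)
    : Prop :=
  s \in `[0, 1] /\ ~ P_rational p s.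

(* The series defining G at the digits i is the R-expansion of the rearranged
   digits i \o n.  A P-rational point has two representations, for which the
   series may take different values; G may use either one at each such point.
   At P-irrational points the value is forced.  Values outside [0, 1] are
   irrelevant. *)
Definition is_G (R : realType) (q : nat) (p r : 'I_q -> R) (n : nat -> nat)
    (G : R -> R) : Prop :=
  forall s, s \in `[0, 1] ->
    exists i : nat -> 'I_q, s = Delta p i /\ G s = Delta r (i \o n).

(* Continuity at s of the restriction of G to [0, 1]: one-sided at 0 and 1. *)
Definition continuous01_at (R : realType) (G : R -> R) (s : R) : Prop :=
  G x @[x --> within `[0, 1]%classic (nbhs s)] --> G s.

Definition discontinuities (R : realType) (G : R -> R) : set R :=
  [set s | s \in `[0, 1] /\ ~ continuous01_at G s].

(* [k0] is max {k : n_k in {1, ..., m}}, with n_{k0} = m and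
   n_1, ..., n_{k0 - 1} in {1, ..., m - 1}; here all indices are shifted. *)
Definition prefix_condition (n : nat -> nat) (m : nat) : Prop :=
  exists k0, [/\ (n k0 <= m)%N, forall k, (n k <= m)%N -> (k <= k0)%N,
    n k0 = m & forall k, (k < k0)%N -> (n k < m)%N].

(* Main.v *)
(** Two digit sequences represent the same number exactly when they are equal
    or adjacent: a common prefix, then digits d and d + 1, then a tail of digits
    q - 1 against a tail of zeros. Near a point s, every representation shares
    its first N digits with some representation of s. Hence G is continuous at s
    if and only if all representations of s give the same value to the series
    of G: numbers whose digits end in 0, 1, 0, 1, ... have one representation
    and approximate s along each of its representations. At a P-rational point
    the series agree exactly when the rearranged digit sequences are adjacent
    again, which is the prefix condition. *)

Require Import Defs.
From mathcomp Require Import zify lra.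

Set Implicit Arguments.
Unset Strict Implicit.
Unset Printing Implicit Defensive.

Local Open Scope classical_set_scope.
Local Open Scope ring_scope.

(** * Digit sequences and the numbers they represent *)

Definition agree (q N : nat) (i j : nat -> 'I_q) : Prop :=
  forall k, (k < N)%N -> i k = j k.

Definition adjacent (q m : nat) (i j : nat -> 'I_q) : Prop :=
  [/\ agree m i j, j m = (i m).+1 :> nat
    & forall k, (m < k)%N -> i k = q.-1 :> nat /\ j k = 0%N :> nat].

Section Expansion.
Variables (R : realType) (q : nat) (p : 'I_q -> R).
Hypotheses (q_gt1 : (1 < q)%N) (p_gt0 : forall j, 0 < p j)
  (sum_p : \sum_j p j = 1).

Lemma cumul_ge0 a : 0 <= cumul p a.
Proof. by apply: sumr_ge0 => j _; exact: ltW. Qed.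

(** The intervals from [cumul p a] to [cumul p a + p a] tile [0, 1] from left to right. What
    separates the tiles of [a] and [b] is the sum over the digits strictly between, empty exactly
    when [b] is the successor of [a]. *)
Lemma cumulS_le (a b : 'I_q) : (a < b)%N ->
  cumul p a + p a <= cumul p b ?= iff (b == a.+1 :> nat).
Proof.
move=> ab; apply/leifP.
have E (c : nat) : (a < c)%N -> \sum_(l < q | (l < c)%N) p l =
    cumul p a + p a + \sum_(l < q | (l < c)%N && (a < l)%N) p l.
  move=> ac; rewrite (bigID (fun l : 'I_q => (a < l)%N)) /= addrC; congr (_ + _).
  rewrite (bigD1 a) /=; last by rewrite ac -leqNgt leqnn.
  rewrite addrC; congr (_ + _); apply: eq_bigl => l.
  by rewrite -val_eqE /=; lia.
have [ba|ba] := eqVneq (b : nat) a.+1.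
  rewrite /cumul (E b)// [X in _ == _ + X]big1 ?addr0//= => l; lia.
have aq : (a.+1 < q)%N by have := ltn_ord b; lia.
rewrite /cumul (E b)// ltrDl (bigD1 (Ordinal aq))/=; last by lia.
by rewrite ltr_wpDr// sumr_ge0// => l _; exact: ltW.
Qed.

Lemma cumulS_le1 (a : 'I_q) : cumul p a + p a <= 1 ?= iff (a == q.-1 :> nat).
Proof.
apply/leifP; rewrite -sum_p (bigID (fun l : 'I_q => (l <= a)%N)) /=.
have -> : \sum_(l < q | (l <= a)%N) p l = cumul p a + p a.
  rewrite (bigD1 a)//= addrC; congr (_ + _); apply: eq_bigl => l.
  by rewrite -val_eqE /=; lia.
have [aq|aq] := eqVneq (a : nat) q.-1.
  by rewrite [X in _ == _ + X]big1 ?addr0//= => l; have := ltn_ord l; lia.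
have aq' : (a.+1 < q)%N by have := ltn_ord a; lia.
rewrite ltrDl (bigD1 (Ordinal aq'))/=; last by lia.
by rewrite ltr_wpDr// sumr_ge0// => l _; exact: ltW.
Qed.

Lemma cumul0 (a : 'I_q) : a = 0%N :> nat -> cumul p a = 0.
Proof. by move=> a0; rewrite /cumul big1// => l; rewrite a0. Qed.

Lemma cumul_gt0 (a : 'I_q) : (0 < a)%N -> 0 < cumul p a.
Proof.
move=> a0; have q0 : (0 < q)%N by lia.
have := cumulS_le (a := Ordinal q0) a0 => -[+ _]; apply: lt_le_trans.
by rewrite ltr_wpDl// cumul_ge0.
Qed.

Lemma p_lt1 a : p a < 1.
Proof.
have [[+ eq1] c0] := (cumulS_le1 a, cumul_ge0 a).
rewrite le_eqVlt eq1 => /orP[/eqP aq|]; last by lra.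
have a0 : (0 < a)%N by lia.
by have := cumul_gt0 a0; have [+ _] := cumulS_le1 a; lra.
Qed.

Let term (i : nat -> 'I_q) k := cumul p (i k) * \prod_(j < k) p (i j).

Let term_ge0 i k : 0 <= term i k.
Proof.
by rewrite mulr_ge0 ?cumul_ge0// prodr_ge0// => j _; exact: ltW.
Qed.

Let seriesS i k :
  series (term i) k.+1 = cumul p (i 0%N) + p (i 0%N) * series (term (i \o succn)) k.
Proof.
rewrite /series /= big_nat_recl// /term big_ord0 mulr1; congr (_ + _).
rewrite big_distrr /=; apply: eq_bigr => l _.
by rewrite big_ord_recl /= mulrCA.
Qed.

Let series_le1 i k : series (term i) k <= 1.
Proof.
elim: k i => [|k IH] i; first by rewrite /series /= big_nil.
rewrite seriesS; have [+ _] := cumulS_le1 (i 0%N); apply: le_trans.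
by rewrite lerD2l ler_piMr// ltW.
Qed.

Let series_cvg i : cvgn (series (term i)).
Proof.
apply: nondecreasing_is_cvgn.
  apply/nondecreasing_seqP => k.
  by rewrite /series /= big_nat_recr//= lerDl.
by exists 1 => _ [k _ <-].
Qed.

Lemma Delta_ge0 i : 0 <= Delta p i.
Proof.
apply: limr_ge; first exact: series_cvg.
by apply: nearW => k; apply: sumr_ge0 => j _; exact: term_ge0.
Qed.

Lemma Delta_le1 i : Delta p i <= 1.
Proof.
apply: limr_le; first exact: series_cvg.
by apply: nearW => k; exact: series_le1.
Qed.

(** Self-similarity: the first digit selects a tile and the remaining digits give the relative
    position in it. The inductions on digits below rest on this. *)
Lemma DeltaS i :
  Delta p i = cumul p (i 0%N) + p (i 0%N) * Delta p (i \o succn).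
Proof.
apply/cvg_lim => //; rewrite -cvg_shiftS.
under eq_fun do rewrite seriesS.
apply: cvgD; first exact: cvg_cst.
by apply: cvgM; [exact: cvg_cst|exact: series_cvg].
Qed.

Lemma Delta_eq0 i : Delta p i = 0 <-> forall k, i k = 0%N :> nat.
Proof.
split=> [i0 k|i0].
  elim: k i i0 => [|k IH] i i0.
    apply/eqP; rewrite -leqn0 leqNgt; apply/negP => /cumul_gt0.
    have := DeltaS i; have := mulr_ge0 (ltW (p_gt0 (i 0%N))) (Delta_ge0 (i \o succn)).
    by lra.
  apply: (IH (i \o succn)); apply/eqP.
  have := DeltaS i; have := cumul_ge0 (i 0%N).
  have := mulr_ge0 (ltW (p_gt0 (i 0%N))) (Delta_ge0 (i \o succn)) => ? ? ?.
  have /eqP : p (i 0%N) * Delta p (i \o succn) = 0 by lra.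
  by rewrite mulf_eq0 gt_eqF.
(* A constant sequence equals its shift, so its value x satisfies x = p x with p < 1. *)
have iS : i \o succn = i by apply/funext => k /=; apply: val_inj; rewrite /= !i0.
have := DeltaS i; rewrite iS cumul0// add0r => /eqP.
rewrite -subr_eq0 -{1}[Delta p i]mul1r -mulrBl mulf_eq0 subr_eq0.
by rewrite gt_eqF ?p_lt1//= => /eqP.
Qed.

Lemma Delta_eq1 i : Delta p i = 1 <-> forall k, i k = q.-1 :> nat.
Proof.
split=> [i1 k|i1].
  elim: k i i1 => [|k IH] i i1.
    have [+ e] := cumulS_le1 (i 0%N); rewrite le_eqVlt e => /orP[/eqP//|].
    have := DeltaS i; rewrite i1.
    have := ler_piMr (ltW (p_gt0 (i 0%N))) (Delta_le1 (i \o succn)).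
    by move=> ? ? ?; exfalso; lra.
  apply: (IH (i \o succn)); apply/eqP.
  have := DeltaS i; have [+ _] := cumulS_le1 (i 0%N).
  have := ler_piMr (ltW (p_gt0 (i 0%N))) (Delta_le1 (i \o succn)) => ? ? ?.
  have /eqP : p (i 0%N) * (Delta p (i \o succn) - 1) = 0 by lra.
  by rewrite mulf_eq0 gt_eqF//= subr_eq0.
have iS : i \o succn = i by apply/funext => k /=; apply: val_inj; rewrite /= !i1.
have := DeltaS i; rewrite iS.
have [_] := cumulS_le1 (i 0%N); rewrite i1 eqxx => /eqP c1 E.
have /eqP : (1 - p (i 0%N)) * (Delta p i - 1) = 0 by lra.
by rewrite mulf_eq0 !subr_eq0 gt_eqF ?p_lt1//= => /eqP.
Qed.

Lemma Delta_adjacent m i j : adjacent m i j -> Delta p i = Delta p j.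
Proof.
elim: m i j => [|m IH] i j [ag s t].
  rewrite (DeltaS i) (DeltaS j).
  have /Delta_eq1 -> : forall k, (i \o succn) k = q.-1 :> nat by move=> k; apply t.
  have /Delta_eq0 -> : forall k, (j \o succn) k = 0%N :> nat by move=> k; apply t.
  have ij : (i 0%N < j 0%N)%N by rewrite s.
  have [_] := cumulS_le ij.
  by rewrite s eqxx mulr1 mulr0 addr0 => /eqP.
rewrite (DeltaS i) (DeltaS j) ag//; congr (_ + _ * _).
by apply: IH; split => [k km||k km]; [exact: ag|exact: s|exact: t].
Qed.

(** At the first differing digit the two numbers lie in different tiles. They can only coincide at a
    common endpoint, where the tail of [i] has value 1 and that of [j] value 0. *)
Let Delta_eq_adjacent m i j : agree m i j -> (i m < j m)%N ->
  Delta p i = Delta p j -> adjacent m i j.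
Proof.
elim: m i j => [|m IH] i j ag ij.
  rewrite (DeltaS i) (DeltaS j).
  have [le_ eq_] := cumulS_le ij.
  have := ler_piMr (ltW (p_gt0 (i 0%N))) (Delta_le1 (i \o succn)).
  have := mulr_ge0 (ltW (p_gt0 (j 0%N))) (Delta_ge0 (j \o succn)) => ? ? ?.
  have /eqP : cumul p (i 0%N) + p (i 0%N) = cumul p (j 0%N) by lra.
  rewrite eq_ => /eqP ji.
  have /eqP : p (i 0%N) * (Delta p (i \o succn) - 1) = 0 by lra.
  rewrite mulf_eq0 gt_eqF//= subr_eq0 => /eqP/Delta_eq1 i1.
  have /eqP : p (j 0%N) * Delta p (j \o succn) = 0 by lra.
  rewrite mulf_eq0 gt_eqF//= => /eqP/Delta_eq0 j0.
  by split => // -[//|k] _; split; [exact: i1|exact: j0].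
rewrite (DeltaS i) (DeltaS j) -ag// => /addrI /mulfI.
rewrite gt_eqF// => /(_ isT) E.
have [ag' s t] : adjacent m (i \o succn) (j \o succn).
  by apply: IH => // k km; exact: ag.
split=> // -[//|k] km; exact: t.
Qed.

Lemma Delta_eqP i j : Delta p i = Delta p j <->
  i = j \/ exists m, adjacent m i j \/ adjacent m j i.
Proof.
split=> [E|[->//|[m [/Delta_adjacent//|/Delta_adjacent//]]]].
have [->|ij] := pselect (i = j); [by left|right].
have /ex_minnP[m ijm mmin] : exists m, i m != j m.
  apply: contrapT => H; apply: ij; apply/funext => k.
  by apply/eqP/negPn/negP => ijk; apply: H; exists k.
have ag : agree m i j.
  by move=> k km; apply/eqP/negPn/negP => /mmin; rewrite leqNgt km.
exists m; move: ijm; rewrite -val_eqE /= neq_ltn => /orP[ijm|jim].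
  by left; exact: Delta_eq_adjacent.
by right; apply: Delta_eq_adjacent => // k /ag.
Qed.

Lemma Delta_modulus e : 0 < e ->
  exists N, forall i j, agree N i j -> `|Delta p i - Delta p j| < e.
Proof.
(* Each shared digit contracts distances by a factor of at most [rho]. *)
move=> e0; pose rho := \big[Order.max/0]_j p j.
have rho_lt1 : rho < 1 by apply: bigmax_lt => // j _; exact: p_lt1.
have rho_ge0 : 0 <= rho by exact: bigmax_ge_id.
have pow N i j : agree N i j -> `|Delta p i - Delta p j| <= rho ^+ N.
  elim: N i j => [|N IH] i j ag.
    have := (Delta_ge0 i, Delta_ge0 j, Delta_le1 i, Delta_le1 j).
    by move=> [[[? ?] ?] ?]; rewrite expr0 ler_norml; lra.
  rewrite (DeltaS i) (DeltaS j) ag// opprD addrACA subrr add0r -mulrBr.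
  rewrite normrM exprS gtr0_norm// ler_pM//; [exact: ltW|exact: le_bigmax|].
  by apply: IH => k kN; exact: ag.
have : rho ^+ N @[N --> \oo] --> (0 : R).
  by apply: cvg_expr; rewrite ger0_norm.
move=> /cvgrPdist_lt/(_ _ e0)[N _ /(_ N (leqnn N))] /=.
rewrite sub0r normrN ger0_norm ?exprn_ge0// => HN.
by exists N => i j /pow /le_lt_trans; apply.
Qed.

Hypothesis Delta_surj : forall s, s \in `[0, 1] -> exists i, s = Delta p i.

(* Self-similarity: a representation of [s] starting with [d] is [d] followed
   by a representation of [(s - cumul p d) / p d]. *)
Lemma near_representation N s : \forall x \near s,
  forall i, Delta p i = x -> exists2 j, Delta p j = s & agree N i j.
Proof.
elim: N s => [|N IH] s.
  have [s01|s01] := boolP (s \in `[0, 1]).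
    have [j ->] := Delta_surj s01.
    by apply: filterE => x i _; exists j.
  have : \forall x \near s, ~ `[0, 1]%classic x.
    apply: open_nbhs_nbhs; split; last exact/negP.
    exact/closed_openC/interval_closed.
  apply: filterS => x x01 i ix; exfalso; apply: x01.
  by rewrite /= in_itv /= -ix Delta_ge0 Delta_le1.
(* Nearby points may start with different digits, so all [d] are treated at once and finitely many
   neighbourhoods are intersected. The rescaled point may leave [0, 1]; this is why [s] ranges over
   all reals. *)
have /filter_forall : forall d : 'I_q, \forall x \near s,
    forall i, Delta p i = (x - cumul p d) / p d ->
    exists2 j, Delta p j = (s - cumul p d) / p d & agree N i j.
  move=> d.
  have C : (x - cumul p d) / p d @[x --> s] --> (s - cumul p d) / p d.
    apply: cvgM; last exact: cvg_cst.
    by apply: cvgB; [exact: cvg_id|exact: cvg_cst].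
  exact: (C _ (IH _)).
apply: filterS => x Hx i ix.
have [|j js ij] := Hx (i 0%N) (i \o succn).
  by rewrite -ix (DeltaS i) addrAC subrr add0r mulrAC mulfV ?mul1r// gt_eqF.
exists (fun k => if k is k'.+1 then j k' else i 0%N).
  by rewrite DeltaS /= js mulrC divfK ?gt_eqF// addrC subrK.
by move=> [|k] //; exact: ij.
Qed.

End Expansion.

Lemma finitely_many_lt (n : nat -> nat) K :
  exists B, forall k, (k < K)%N -> (n k < B)%N.
Proof.
exists (\max_(k < K) n k).+1 => k kK.
by rewrite ltnS (leq_bigmax (Ordinal kK)).
Qed.

(** The first M rearranged digits involve only finitely many of the original digits. *)
Lemma Delta_comp_modulus (R : realType) (q : nat) (r : 'I_q -> R)
    (n : nat -> nat) e :
  (1 < q)%N -> (forall j, 0 < r j) -> \sum_j r j = 1 -> 0 < e ->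
  exists N, forall i j, agree N i j ->
    `|Delta r (i \o n) - Delta r (j \o n)| < e.
Proof.
move=> q1 r0 r1 e0; have [M HM] := Delta_modulus q1 r0 r1 e0.
have [N nN] := finitely_many_lt n M.
by exists N => i j ag; apply: HM => k /nN /ag.
Qed.

(** * Points with a unique representation *)

Section Alternating.
Variables (q : nat) (q_gt1 : (1 < q)%N).

(* Agrees with [i] up to [N] but has no constant tail, hence is the unique
   representation of its value. *)
Definition alternate (N : nat) (i : nat -> 'I_q) (k : nat) : 'I_q :=
  if (k < N)%N then i k
  else if odd k then Ordinal q_gt1 else Ordinal (ltnW q_gt1).

Lemma agree_alternate N i : agree N i (alternate N i).
Proof. by move=> k kN; rewrite /alternate kN. Qed.

Lemma alternate_tail m N i (d : 'I_q) :
  ~ (forall k, (m < k)%N -> alternate N i k = d :> nat).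
Proof.
(* Positions [K] and [K.+1] lie beyond [m] and [N] and carry the digits 0 and 1. *)
have [K oK mNK] : exists2 K, odd K = false & (m + N < K)%N.
  by exists (m + N).+1.*2; [rewrite odd_double|lia].
move=> H; have := H K; have := H K.+1.
rewrite /alternate !(@leq_gtF N) /= ?oK /=; lia.
Qed.

Lemma alternate_unique (R : realType) (p : 'I_q -> R) N i j :
  (forall j, 0 < p j) -> \sum_j p j = 1 ->
  Delta p j = Delta p (alternate N i) -> j = alternate N i.
Proof.
move=> p0 p1 /(Delta_eqP q_gt1 p0 p1) [//|[m adj]]; exfalso.
have q1q : (q.-1 < q)%N by lia.
by case: adj => -[_ _ t];
  [apply: (@alternate_tail m N i (Ordinal (ltnW q_gt1)))
  |apply: (@alternate_tail m N i (Ordinal q1q))] => k /t[].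
Qed.

End Alternating.

(** * Continuity and discontinuities of [G] *)

Section Continuity.
Variables (R : realType) (q : nat) (p r : 'I_q -> R).
Hypotheses (q_gt1 : (1 < q)%N) (p_gt0 : forall j, 0 < p j)
  (r_gt0 : forall j, 0 < r j) (sum_p : \sum_j p j = 1) (sum_r : \sum_j r j = 1).
Variables (n : nat -> nat) (G : R -> R).
Hypothesis (GE : is_G p r n G).

Let Delta01 i : Delta p i \in `[0, 1].
Proof. by rewrite in_itv /= Delta_ge0// Delta_le1. Qed.

(** Here [is_G] leaves no choice of representation. *)
Lemma is_G_alternate N i : G (Delta p (alternate q_gt1 N i)) =
  Delta r (alternate q_gt1 N i \o n).
Proof.
by have [j [/esym/alternate_unique -> // ->]] := GE (Delta01 (alternate q_gt1 N i)).
Qed.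

Lemma continuous01_atP s : s \in `[0, 1] -> continuous01_at G s <->
  forall i, Delta p i = s -> G s = Delta r (i \o n).
Proof.
move=> s01; split=> [Gs i is_|H].
  (* Along these points [G] tends both to [G s] and to the series at [i]; limits are unique. *)
  pose x N := Delta p (alternate q_gt1 N i).
  have xs : x N @[N --> \oo] --> s.
    apply/cvgrPdist_lt => e /(Delta_modulus q_gt1 p_gt0 sum_p)[N HN].
    exists N => // M /= NM; rewrite -is_; apply: HN => k kN.
    by apply: agree_alternate; exact: leq_trans NM.
  have xw : x N @[N --> \oo] --> within `[0, 1]%classic (nbhs s).
    move=> A /xs; apply: (@filterS _ \oo) => N; apply.
    exact: Delta01.
  apply: (@cvg_unique _ _ (G (x N) @[N --> \oo])) => //.
    exact: cvg_comp xw Gs.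
  apply/cvgrPdist_lt => e /(Delta_comp_modulus n q_gt1 r_gt0 sum_r)[N HN].
  exists N => // M /= NM; rewrite is_G_alternate; apply: HN => k kN.
  by apply: agree_alternate; exact: leq_trans NM.
apply/cvgrPdist_lt => e /(Delta_comp_modulus n q_gt1 r_gt0 sum_r)[N HN].
(* [is_G] itself provides a representation of every point. *)
have surj t : t \in `[0, 1] -> exists i, t = Delta p i.
  by move=> /GE[i [-> _]]; exists i.
have := near_representation q_gt1 p_gt0 sum_p surj N s.
apply: filterS => x Hx /= x01.
have [i [xi ->]] := GE x01.
have [j js ij] := Hx i (esym xi).
by rewrite (H j js) distrC; apply: HN.
Qed.

(** Two distinct representations would be adjacent, and the one ending in zeros would make [s]
    P-rational. *)
Lemma continuous01_P_irrational s : P_irrational p s -> continuous01_at G s.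
Proof.
move=> [s01 irr]; apply/continuous01_atP => // i is_.
have [j [sj ->]] := GE s01; congr (Delta r (_ \o n)).
have : Delta p j = Delta p i by rewrite is_ sj.
move=> /(Delta_eqP q_gt1 p_gt0 sum_p)[//|[m adj]]; exfalso; apply: irr.
case: adj => -[_ s1 t]; [exists m, i|exists m, j]; split=> //; split.
- by rewrite s1.
- by move=> k /t[].
- by rewrite s1.
- by move=> k /t[].
Qed.

(* The other representation of a point with the digits [i], [zero_tail m i]. *)
Definition left_digits (m : nat) (i : nat -> 'I_q) (k : nat) : 'I_q :=
  if (k < m)%N then i k
  else insubd (i k) (if k == m then (i m).-1 else q.-1).

Lemma adjacent_left_digits m i : zero_tail m i -> adjacent m (left_digits m i) i.
Proof.
move=> [im iz]; rewrite /left_digits; split.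
- by move=> k km; rewrite km.
(* The values given to [insubd] are below [q], so its default never occurs. *)
- by rewrite ltnn eqxx val_insubd ifT; have := ltn_ord (i m); lia.
- move=> k km; rewrite ltnNge ltnW//= gtn_eqF// val_insubd ifT; last by lia.
  by split => //; exact: iz.
Qed.

(** Adjacency at an index before [m] would make the digit of [i] at [m] zero; after [m] it would
    need a nonzero digit in the zero tail. In the opposite orientation [i] would end in digits q -
    1. *)
Lemma Delta_eq_zero_tail m i j : zero_tail m i -> Delta p j = Delta p i ->
  j = i \/ adjacent m j i.
Proof.
move=> [im iz] /(Delta_eqP q_gt1 p_gt0 sum_p)[|[l [adj|[_ _ t]]]]; first by left.
  suff <- : l = m by right.
  case: adj => _ il t; have [lm|ml|//] := ltngtP l m.
    by move: im; have [_ ->] := t _ lm.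
  by move: il; rewrite iz.
have [|] := t (m + l).+1; first lia.
rewrite iz; lia.
Qed.

Lemma rearrangement_unbounded (m K : nat) : rearrangement n ->
  exists2 k, (K <= k)%N & (m < n k)%N.
Proof.
(* A value of at least [B] cannot be taken at a position below [K]. *)
move=> [_ surj]; have [B HB] := finitely_many_lt n K.
have [k nk] := surj (maxn B m.+1); exists k; last by rewrite nk leq_max ltnSn orbT.
by rewrite leqNgt; apply/negP => /HB; rewrite nk; lia.
Qed.

Lemma continuous01_zero_tail m i : rearrangement n -> zero_tail m i ->
  continuous01_at G (Delta p i) <-> prefix_condition n m.
Proof.
move=> nP im; have [[n_inj n_surj] [im0 iz]] := (nP, im).
have adj := adjacent_left_digits im.
rewrite (continuous01_atP (Delta01 i)); split; last first.
  move=> [k0 [_ kmax nk0 klt]].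
  have H j : Delta p j = Delta p i -> Delta r (j \o n) = Delta r (i \o n).
    move=> /(Delta_eq_zero_tail im)[->//|[ag s1 t]].
    apply: (@Delta_adjacent _ _ _ q_gt1 r_gt0 sum_r k0); split => /=.
    - by move=> k /klt /ag.
    - by rewrite nk0.
    - move=> k kk0; apply: t; rewrite ltnNge; apply/negP => /kmax.
      by rewrite leqNgt kk0.
  by move=> j ji; have [l [li ->]] := GE (Delta01 i); rewrite !H.
move=> H; have := H i erefl.
rewrite (H _ (Delta_adjacent q_gt1 p_gt0 sum_p adj)).
move: (left_digits m i) adj => j [ag s1 t].
have [k nk] := n_surj m.
move=> /(Delta_eqP q_gt1 r_gt0 sum_r)[/(congr1 (@^~ k))/=|[l [|] [agl sl tl]]].
- by rewrite nk => ji; move: s1; rewrite ji; lia.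
(* [i] and [j] agree before [m] and differ from [m] on. So the common prefix reads indices below
   [m], the tail reads indices from [m] on, and position [l] is left for [m]. *)
- rewrite /= in sl tl.
  have gtl k' : (l < k')%N -> (m <= n k')%N.
    move=> lk; rewrite leqNgt; apply/negP => /ag e.
    by have [] := tl k' lk; rewrite e; lia.
  have ltl k' : (k' < l)%N -> (n k' < m)%N.
    move=> /agl/= e; case: (ltngtP (n k') m) => // [/t[]|nk'].
      by rewrite e; lia.
    by move: s1; rewrite -nk' e; lia.
  have nl : n l = m.
    case: (ltngtP (n l) m) => // [/ag e|/t[]]; last by lia.
    by move: sl; rewrite e; lia.
  exists l; split => //; first by rewrite nl.
  move=> k' nk'; rewrite leqNgt; apply/negP => lk.
  have := gtl _ lk; have : n k' <> n l by move=> /n_inj; lia.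
  lia.
(* The opposite orientation fails far out, where [j] still has the digit q - 1 and [i] the digit
   0. *)
- have [k' lk' mk'] := rearrangement_unbounded m l.+1 nP.
  have := t _ mk'; have := tl _ lk' => /=; lia.
Qed.

Lemma discontinuities_zero_tail s : rearrangement n -> discontinuities G s ->
  exists m i, [/\ zero_tail m i, s = Delta p i & ~ prefix_condition n m].
Proof.
move=> nP [s01 ds].
have [[m [i [im si]]]|irr] := pselect (P_rational p s).
  exists m, i; split => // /(continuous01_zero_tail nP im).
  by rewrite -si.
by exfalso; apply: ds; exact: continuous01_P_irrational.
Qed.

Lemma zero_tail_discontinuities m i : rearrangement n -> zero_tail m i ->
  ~ prefix_condition n m -> discontinuities G (Delta p i).
Proof. by move=> nP im H; split => // /(continuous01_zero_tail nP im). Qed.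

Lemma countable_discontinuities : rearrangement n ->
  countable (discontinuities G).
Proof.
move=> nP; pose d0 := Ordinal (ltnW q_gt1).
(* Each discontinuity is given by a finite word, padded with zeros through the default of [nth]. *)
apply: (@sub_countable _ _ _
    ((fun l => Delta p (nth d0 l)) @` [set: seq 'I_q])); last first.
  apply: (sub_countable (card_image_le _ _)); exact: countableP.
apply: subset_card_le => s /(discontinuities_zero_tail nP)[m [i [[im iz] -> _]]].
exists (mkseq i m.+1) => //; congr (Delta p _); apply/funext => k.
have [km|mk] := ltnP k m.+1; first by rewrite nth_mkseq.
by rewrite nth_default ?size_mkseq//; apply: val_inj; rewrite /= iz.
Qed.

End Continuity.

(** * Rearrangements with no, finitely many and infinitely many discontinuities *)

Section Examples.
Variables (R : realType) (q : nat) (p r : 'I_q -> R).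
Hypotheses (q_gt1 : (1 < q)%N) (p_gt0 : forall j, 0 < p j)
  (r_gt0 : forall j, 0 < r j) (sum_p : \sum_j p j = 1) (sum_r : \sum_j r j = 1).

(** Supplies one P-rational point for each position [m] of the last nonzero digit. *)
Definition unit_digits (m k : nat) : 'I_q :=
  if k == m then Ordinal q_gt1 else Ordinal (ltnW q_gt1).

Lemma zero_tail_unit_digits m : zero_tail m (unit_digits m).
Proof.
by rewrite /unit_digits; split => [|k mk]; rewrite ?eqxx// gtn_eqF.
Qed.

Lemma Delta_unit_digits_inj : injective (fun m => Delta p (unit_digits m)).
Proof.
move=> m l /= /(Delta_eq_zero_tail q_gt1 p_gt0 sum_p (zero_tail_unit_digits l)).
move=> [/(congr1 (@^~ m))|[_ _ /(_ (m + l).+1) []]].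
- by rewrite /unit_digits eqxx; case: eqP.
- by lia.
- by rewrite /unit_digits gtn_eqF/=; lia.
Qed.

Lemma involutive_rearrangement n : involutive n -> rearrangement n.
Proof.
by move=> nK; split=> [|N]; [exact: can_inj nK|exists (n N); rewrite nK].
Qed.

Lemma discontinuities_id G : is_G p r id G -> discontinuities G = set0.
Proof.
move=> GE; apply/seteqP; split=> // s.
have nP : rearrangement id by apply: involutive_rearrangement.
move=> /(discontinuities_zero_tail q_gt1 p_gt0 r_gt0 sum_p sum_r GE nP).
by move=> [m [i [_ _]]]; apply; exists m; split.
Qed.

Definition swap01 (k : nat) : nat :=
  if k is 0%N then 1%N else if k is 1%N then 0%N else k.

Lemma swap01K : involutive swap01.
Proof. by move=> [|[|k]]. Qed.

(** For [m] = 0 the larger index 1 is read first; for [m] = 1 the index 0 is read after it. From 2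
    on, [m] is fixed and only smaller indices precede it. *)
Lemma prefix_condition_swap01 m : prefix_condition swap01 m <-> (1 < m)%N.
Proof.
split=> [[k [_ kmax nk klt]]|].
  case: m kmax nk klt => [|[|m//]]; case: k => [|[|k]]// kmax _ klt.
    exact: (klt 0%N).
  exact: (kmax 1%N).
by case: m => [|[|m]]// _; exists m.+2; split => // -[|[|k]].
Qed.

Lemma finite_discontinuities_swap01 G : is_G p r swap01 G ->
  finite_set (discontinuities G) /\ discontinuities G !=set0.
Proof.
move=> GE; have nP := involutive_rearrangement swap01K; split; last first.
  exists (Delta p (unit_digits 0)).
  apply: (zero_tail_discontinuities q_gt1 p_gt0 r_gt0 sum_p sum_r GE nP
    (zero_tail_unit_digits 0)).
  by move=> /prefix_condition_swap01.
pose d0 := Ordinal (ltnW q_gt1).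
(* Discontinuities have [m] at most 1, so two digits determine them. *)
apply: (@sub_finite_set _ _ ((fun ab => Delta p (nth d0 [:: ab.1; ab.2])) @`
    [set: 'I_q * 'I_q])); last by apply: finite_image; exact: finite_finset.
move=> s /(discontinuities_zero_tail q_gt1 p_gt0 r_gt0 sum_p sum_r GE nP).
move=> [m [i [[im iz] -> /prefix_condition_swap01/negP]]]; rewrite -leqNgt => m1.
exists (i 0%N, i 1%N) => //; congr (Delta p _); apply/funext => -[|[|k]] //=.
by apply: val_inj; rewrite nth_nil /= iz//; lia.
Qed.

Definition swap_pairs (k : nat) : nat := if odd k then k.-1 else k.+1.

Lemma swap_pairsK : involutive swap_pairs.
Proof.
by move=> [//|k]; rewrite /swap_pairs /=; case: (boolP (odd k)) => /= [->|/negbTE ->].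
Qed.

(** An even [m] is read just after [m.+1], an odd [m] just before [m.-1]; both violate the
    condition. *)
Lemma prefix_condition_swap_pairs m : ~ prefix_condition swap_pairs m.
Proof.
move=> [k [_ kmax nk klt]].
have {nk}km : k = swap_pairs m by rewrite -nk swap_pairsK.
have := kmax m; have := klt m; rewrite km /swap_pairs.
by case: (boolP (odd m)) => [|_]; [case: (m) => //|]; lia.
Qed.

Lemma infinite_discontinuities_swap_pairs G : is_G p r swap_pairs G ->
  infinite_set (discontinuities G).
Proof.
move=> GE; have nP := involutive_rearrangement swap_pairsK.
apply: (@sub_infinite_set _ [set Delta p (unit_digits m) | m in [set: nat]]).
  move=> _ [m _ <-].
  exact: (zero_tail_discontinuities q_gt1 p_gt0 r_gt0 sum_p sum_r GE nP
    (zero_tail_unit_digits m) (@prefix_condition_swap_pairs m)).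
rewrite (eq_finite_set (inj_card_eq _)).
  exact: infinite_nat.
by move=> m l _ _; exact: Delta_unit_digits_inj.
Qed.

End Examples.

Theorem theorem2 (R : realType) (q : nat) (p r : 'I_q -> R)
    (hq : (1 < q)%N)
    (hp : forall j, 0 < p j) (hr : forall j, 0 < r j)
    (hp1 : \sum_j p j = 1) (hr1 : \sum_j r j = 1) :
  (forall (n : nat -> nat) (G : R -> R),
    rearrangement n -> is_G p r n G ->
    [/\ (* (1) *)
        forall s, P_irrational p s -> continuous01_at G s,
        (* (2) *)
        forall (m : nat) (i : nat -> 'I_q), zero_tail m i ->
          (prefix_condition n m -> continuous01_at G (Delta p i)) /\
          (~ prefix_condition n m -> ~ continuous01_at G (Delta p i))
      & (* (3): at most countable, i.e. countably infinite, finite or empty *)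
        countable (discontinuities G)]) /\
  (* (3), dependence on the sequence: each of the three cases occurs *)
  [/\ exists n, rearrangement n /\
        forall G, is_G p r n G -> discontinuities G = set0,
      exists n, rearrangement n /\
        forall G, is_G p r n G ->
          finite_set (discontinuities G) /\ discontinuities G !=set0
    & exists n, rearrangement n /\
        forall G, is_G p r n G -> infinite_set (discontinuities G)].
Proof.
split=> [n G nP GE|].
  split; first exact: (continuous01_P_irrational hq hp hr hp1 hr1 GE).
    move=> m i im.
    have cE := continuous01_zero_tail hq hp hr hp1 hr1 GE nP im.
    by split=> [/cE//|npc /cE].
  exact: (countable_discontinuities hq hp hr hp1 hr1 GE nP).
split; [exists id|exists swap01|exists swap_pairs].
- split=> [|G]; first by apply: involutive_rearrangement.
  exact: discontinuities_id.
- split=> [|G]; first exact: (involutive_rearrangement swap01K).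
  exact: finite_discontinuities_swap01.
- split=> [|G]; first exact: (involutive_rearrangement swap_pairsK).
  exact: infinite_discontinuities_swap_pairs.
Qed.
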